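(* Let $\mathcal{G}$ be a connected weighted undirected graph on $V=\{1,\dots,n\}$, let $V_L=\{v_1,\dots,v_m\}\subset V$ be a set of $m$ leader agents, and let $r\in\{1,\dots,m\}$. For $V_{\rm demotion}\subset V_L$, let $g(V_{\rm demotion}):=f(\tilde V_L^* )$, where $\tilde V_L^*$ is a global optimal solution of the problem of minimizing $f(\tilde V_L)=\|G-\tilde G\|_{H^2}^2$ over new leader sets $\tilde V_L\subset V\setminus V_{\rm demotion}$ with $|\tilde V_L|=m-|V_{\rm demotion}|$. Consider the leader demotion problem: minimize $g(V_{\rm demotion})$ over all $V_{\rm demotion}\subset V_L$ with $|V_{\rm demotion}|=r$. Then any $V_{\rm demotion}\subset V_L$ with $|V_{\rm demotion}|=r$ is a solution of the leader demotion problem, and $$g(V_{\rm demotion})=\frac{r}{2}\left(1-\frac1n\right).$$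
   Context: Graph: $\mathcal{G}=(V,E,A)$ is a connected weighted undirected simple graph with vertex set $V=\{1,\dots,n\}$ and symmetric adjacency matrix $A=(a_{ij})$, where $a_{ij}=a_{ji}>0$ if $\{i,j\}$ is an edge and $a_{ij}=0$ otherwise (in particular $a_{ii}=0$). The degree matrix is $D={\rm diag}(d_1,\dots,d_n)$, $d_i=\sum_{j=1}^n a_{ij}$, and the Laplacian is $L=D-A$. Number the edges $1,\dots,k$, let $W={\rm diag}(w_1,\dots,w_k)$ be the diagonal matrix of edge weights, orient each edge arbitrarily, and let $R\in\mathbf{R}^{n\times k}$ be the incidence matrix: $R_{ij}=1$ if vertex $i$ is the source of edge $j$, $R_{ij}=-1$ if vertex $i$ is the sink of edge $j$, and $R_{ij}=0$ otherwise. (Then $L=RWR^T$.) Original system: $V_L=\{v_1,\dots,v_m\}\subset V$ consists of $m$ distinct vertices. $M\in\mathbf{R}^{n\times m}$ has $M_{il}=1$ if $i=v_l$ and $M_{il}=0$ otherwise. The system is $\dot x=-Lx+Mu$, $y=W^{1/2}R^Tx$, with transfer function $G(s)=W^{1/2}R^T(sI_n+L)^{-1}M$. New system: $V_{\rm demotion}=\{v_l: l\in J\}\subset V_L$, $J\subset\{1,\dots,m\}$, is the set of demoted leaders. A new leader set is an indexed set $\tilde V_L=\{\tilde v_l: l\in\{1,\dots,m\}\setminus J\}$ of pairwise distinct vertices of $V\setminus V_{\rm demotion}$. $\tilde M\in\mathbf{R}^{n\times m}$ has $\tilde M_{il}=1$ if $l\notin J$ and $i=\tilde v_l$, and $\tilde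 M_{il}=0$ otherwise (so the columns with index in $J$ are zero). The system is $\dot{\tilde x}=-L\tilde x+\tilde Mu$, $\tilde y=W^{1/2}R^T\tilde x$, with transfer function $\tilde G(s)=W^{1/2}R^T(sI_n+L)^{-1}\tilde M$. The indexing of $\tilde V_L$ determines $\tilde M$, and the minimization of $f$ is over all such indexed sets; thus $g(V_{\rm demotion})$ is the minimum value of $f$. Norm: for a matrix function $H(s)$, $\|H\|_{H^2}=\sqrt{\frac{1}{2\pi}\int_{-\infty}^{\infty}\|H(i\omega)\|_F^2\,d\omega}$, where $\|B\|_F=\sqrt{{\rm tr}(B^\dagger B)}$ is the Frobenius norm and $\dagger$ is Hermitian conjugation (the integrands here are defined for all $\omega\ne0$). *)

(* Defs.v *)
(* MathComp / MathComp-Analysis, over an arbitrary R : realType. *)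
From HB Require Import structures.
From mathcomp Require Import all_boot all_order all_algebra.
From mathcomp Require Import all_classical all_reals all_analysis.
From mathcomp Require Import complex.

Set Implicit Arguments.
Unset Strict Implicit.
Unset Printing Implicit Defensive.

Import Order.TTheory GRing.Theory Num.Theory.

Local Open Scope ring_scope.

Definition adjacent (R : realType) (n : nat) (A : 'M[R]_n) : rel 'I_n :=
  fun i j => 0 < A i j.

Definition connected_weighted_graph (R : realType) (n : nat) (A : 'M[R]_n)
    : Prop :=
  [/\ A^T = A, forall i j, 0 <= A i j, forall i, A i i = 0 &
      forall i j, connect (adjacent A) i j].

(* The edges are numbered by 'I_k, and edge e is oriented from src e to snk e:
   every edge {i, j} has exactly one number, hence one of its two
   orientations. *)
Definition oriented_edge_numbering (R : realType) (n k : nat) (A : 'M[R]_n)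
    (src snk : 'I_k -> 'I_n) : Prop :=
  (forall e, adjacent A (src e) (snk e)) /\
  (forall i j, adjacent A i j ->
     exists! e, (src e = i /\ snk e = j) \/ (src e = j /\ snk e = i)).

Definition degree_matrix (R : realType) (n : nat) (A : 'M[R]_n) : 'M[R]_n :=
  diag_mx (\row_i \sum_j A i j).

Definition laplacian (R : realType) (n : nat) (A : 'M[R]_n) : 'M[R]_n :=
  degree_matrix A - A.

Definition incidence (R : realType) (n k : nat) (src snk : 'I_k -> 'I_n)
    : 'M[R]_(n, k) :=
  \matrix_(i, e) (if i == src e then 1 else if i == snk e then -1 else 0).

Definition sqrt_weights (R : realType) (n k : nat) (A : 'M[R]_n)
    (src snk : 'I_k -> 'I_n) : 'M[R]_k :=
  diag_mx (\row_e Num.sqrt (A (src e) (snk e))).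

Definition output_matrix (R : realType) (n k : nat) (A : 'M[R]_n)
    (src snk : 'I_k -> 'I_n) : 'M[R]_(k, n) :=
  sqrt_weights A src snk *m (incidence R src snk)^T.

Definition complexify (R : realType) (p q : nat) (B : 'M[R]_(p, q))
    : 'M[R[i]]_(p, q) :=
  map_mx (real_complex R) B.

Definition hermitian_conj (R : realType) (p q : nat) (B : 'M[R[i]]_(p, q))
    : 'M[R[i]]_(q, p) :=
  map_mx (@conjc R) B^T.

(* The trace is a nonnegative real number; Re only changes its type. *)
Definition frobenius_norm (R : realType) (p q : nat) (B : 'M[R[i]]_(p, q)) : R :=
  Num.sqrt (complex.Re (\tr (hermitian_conj B *m B))).

(* Extended-real valued, so that a divergent integral gives +oo. The junk
   value of a transfer function with a pole at 0 does not matter, the point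
   0 being negligible. *)
Definition H2_norm (R : realType) (p q : nat) (H : R[i] -> 'M[R[i]]_(p, q))
    : \bar R :=
  sqrte (((2 * pi)^-1)%:E *
         \int[@lebesgue_measure R]_(w in setT)
            ((frobenius_norm (H (Complex 0 w))) ^+ 2)%:E)%E.

Definition leader_set (n m : nat) (v : 'I_m -> 'I_n) : {set 'I_n} :=
  [set v l | l : 'I_m].

Definition leader_matrix (R : realType) (n m : nat) (v : 'I_m -> 'I_n)
    : 'M[R]_(n, m) :=
  \matrix_(i, l) (i == v l)%:R.

(* The indices in {1, ..., m} \ J, where Vd = {v_l : l in J}. *)
Definition kept (n m : nat) (v : 'I_m -> 'I_n) (Vd : {set 'I_n}) : finType :=
  {l : 'I_m | v l \notin Vd}.

Definition new_leaders (n m : nat) (v : 'I_m -> 'I_n) (Vd : {set 'I_n})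
    : {set {ffun kept v Vd -> 'I_n}} :=
  [set vt : {ffun kept v Vd -> 'I_n} |
     injectiveb vt && [forall l, vt l \notin Vd]].

Definition new_leader_matrix (R : realType) (n m : nat) (v : 'I_m -> 'I_n)
    (Vd : {set 'I_n}) (vt : {ffun kept v Vd -> 'I_n}) : 'M[R]_(n, m) :=
  \matrix_(i, l) [exists l' : kept v Vd, (val l' == l) && (i == vt l')]%:R.

(* W^(1/2) R^T (s I + L)^-1 B. At an eigenvalue s of - L, where it is
   undefined, invmx returns a junk value. *)
Definition leader_transfer (R : realType) (n m k : nat) (A : 'M[R]_n)
    (src snk : 'I_k -> 'I_n) (B : 'M[R]_(n, m)) (s : R[i]) : 'M[R[i]]_(k, m) :=
  complexify (output_matrix A src snk) *m
  invmx (s%:M + complexify (laplacian A)) *m complexify B.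

(* f of the new leader set vt: the squared H^2 norm of G - Gtilde. *)
Definition selection_cost (R : realType) (n m k : nat) (A : 'M[R]_n)
    (src snk : 'I_k -> 'I_n) (v : 'I_m -> 'I_n) (Vd : {set 'I_n})
    (vt : {ffun kept v Vd -> 'I_n}) : \bar R :=
  (H2_norm (fun s => (leader_transfer A src snk (leader_matrix R v) s -
                      leader_transfer A src snk (new_leader_matrix R vt) s)%R)
   ^+ 2)%E.

Definition remaining_leaders (n m : nat) (v : 'I_m -> 'I_n) (Vd : {set 'I_n})
    : {ffun kept v Vd -> 'I_n} :=
  [ffun l => v (val l)].

Definition optimal_new_leaders (R : realType) (n m k : nat) (A : 'M[R]_n)
    (src snk : 'I_k -> 'I_n) (v : 'I_m -> 'I_n) (Vd : {set 'I_n})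
    (vt : {ffun kept v Vd -> 'I_n}) : Prop :=
  vt \in new_leaders v Vd /\
  forall vt', vt' \in new_leaders v Vd ->
    (selection_cost A src snk vt <= selection_cost A src snk vt')%E.

(* The optimum of the selection problem. The remaining leaders only
   serve as a feasible default: see demotion_costE below. *)
Definition demotion_cost (R : realType) (n m k : nat) (A : 'M[R]_n)
    (src snk : 'I_k -> 'I_n) (v : 'I_m -> 'I_n) (Vd : {set 'I_n}) : \bar R :=
  selection_cost A src snk
    [arg min_(vt < remaining_leaders v Vd in new_leaders v Vd)
       selection_cost A src snk vt]%O.

Definition demotion_feasible (n m : nat) (v : 'I_m -> 'I_n) (r : nat)
    (Vd : {set 'I_n}) : Prop :=
  Vd \subset leader_set v /\ #|Vd| = r.

Definition demotion_solution (R : realType) (n m k : nat) (A : 'M[R]_n)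
    (src snk : 'I_k -> 'I_n) (v : 'I_m -> 'I_n) (r : nat) (Vd : {set 'I_n})
    : Prop :=
  demotion_feasible v r Vd /\
  forall Vd', demotion_feasible v r Vd' ->
    (demotion_cost A src snk v Vd <= demotion_cost A src snk v Vd')%E.

Lemma remaining_leadersP (n m : nat) (v : 'I_m -> 'I_n) (Vd : {set 'I_n}) :
  injective v -> remaining_leaders v Vd \in new_leaders v Vd.
Proof.
move=> v_inj; rewrite inE; apply/andP; split.
  by apply/injectiveP => l l'; rewrite !ffunE => /v_inj /val_inj.
by apply/forallP => l; rewrite ffunE (valP l).
Qed.

Lemma optimal_new_leaders_exists (R : realType) (n m k : nat) (A : 'M[R]_n)
    (src snk : 'I_k -> 'I_n) (v : 'I_m -> 'I_n) (Vd : {set 'I_n}) :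
  injective v ->
  exists vt : {ffun kept v Vd -> 'I_n}, optimal_new_leaders A src snk vt.
Proof.
move=> v_inj.
exists [arg min_(vt < remaining_leaders v Vd in new_leaders v Vd)
          selection_cost A src snk vt]%O.
by case: arg_minP => [|vt vtP vt_min]; [exact: remaining_leadersP | split].
Qed.

Lemma demotion_costE (R : realType) (n m k : nat) (A : 'M[R]_n)
    (src snk : 'I_k -> 'I_n) (v : 'I_m -> 'I_n) (Vd : {set 'I_n})
    (vt : {ffun kept v Vd -> 'I_n}) :
  injective v -> optimal_new_leaders A src snk vt ->
  demotion_cost A src snk v Vd = selection_cost A src snk vt.
Proof.
move=> v_inj [vtP vt_min]; rewrite /demotion_cost.
case: arg_minP => [|vt' vt'P vt'_min]; first exact: remaining_leadersP.
by apply/le_anti/andP; split; [exact: vt'_min | exact: vt_min].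
Qed.

(* Main.v *)
Require Import Defs.
From mathcomp Require Import all_boot all_order all_algebra.
From mathcomp Require Import all_classical all_reals all_analysis.
From mathcomp Require Import complex spectral ring measurable_realfun.

(** The theorem rests on one formula: replacing the input matrix by another
one whose difference with it is B changes the transfer function by an H^2
norm whose square is tr (B^T (I - J / n) B) / 2, where J is the all-ones
matrix ([sqr_H2_norm_resolvent], [selection_cost_trace]).

To see this, write L = Q^T Q with Q = W^(1/2) R^T ([laplacian_gram]) and
diagonalize L by a unitary matrix U, with eigenvalues d_j >= 0
([gram_spectral]). In the eigenbasis the squared Frobenius norm of
Q (i w + L)^-1 B is the sum of the terms c_j d_j / (w^2 + d_j^2), c_j being
the squared norm of the j-th row of U B
([sqr_frobenius_norm_resolvent]). A Lorentzian d / (w^2 + d^2) has integral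
pi whatever d > 0 is ([integral_lorentzian]), so the edge weights and the
eigenvalues disappear: after division by 2 pi there remains half the sum of
the c_j with d_j <> 0. That sum is the squared norm of the projection of B
away from the kernel of L, and since the graph is connected this kernel
consists of the constant vectors, with orthogonal projection J / n
([output_matrix_kernel], [kernel_projection]).

The trace is a sum over the columns of B, that is, over the leaders. A demoted
leader contributes the column e_v, of centered squared norm 1 - 1/n; a kept
leader contributes e_v - e_v', which is already centered and has squared
norm 2 if v' <> v and 0 if v' = v ([selection_costE]). So the cost of a
selection is (r / 2) (1 - 1/n) plus the number of kept leaders that are
moved. Keeping the remaining leaders in place is therefore optimal, and the
optimal value depends on the demoted set through its cardinality only. *)

Set Implicit Arguments.
Unset Strict Implicit.
Unset Printing Implicit Defensive.

Import Order.TTheory GRing.Theory Num.Theory.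
Import numFieldNormedType.Exports.

Local Open Scope ring_scope.

(** * The integral of a Lorentzian *)

Lemma lorentzian_continuous (R : realType) (d : R) : 0 < d ->
  continuous (fun x : R => d / (x ^+ 2 + d ^+ 2)).
Proof.
move=> d0 x; apply: cvgM; first exact: cvg_cst.
apply: cvgV; first by rewrite gt_eqF// ltr_wpDl ?sqr_ge0// exprn_gt0.
by apply: cvgD; [exact: exprn_continuous|exact: cvg_cst].
Qed.

(** The primitive is atan (x / d), whose total variation over the line does not
depend on d. *)
Lemma integral_lorentzian (R : realType) (d : R) : 0 < d ->
  (\int[@lebesgue_measure R]_x (d / (x ^+ 2 + d ^+ 2))%:E = pi%:E)%E.
Proof.
move=> d0; have cf := lorentzian_continuous d0.
have f_ge0 (x : R) : 0 <= d / (x ^+ 2 + d ^+ 2).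
  by rewrite divr_ge0 ?(ltW d0)// addr_ge0 ?sqr_ge0.
rewrite ge0_symfun_integralT//; last by move=> x /=; rewrite sqrrN.
rewrite -set_itvcy.
have dF (x : R) :
    is_derive x (1 : R) (fun x => atan (x / d)) (d / (x ^+ 2 + d ^+ 2)).
  apply: is_derive_eq.
  rewrite /GRing.scale/=.
  by field; rewrite ?gt_eqF// ltr_wpDl ?sqr_ge0// exprn_gt0.
rewrite (@ge0_continuous_FTC2y _ _ (fun x => atan (x / d)) 0 (pi / 2))//=.
- by rewrite mul0r atan0 sube0 -EFinM mulrC divfK.
- by apply: continuous_in_subspaceT => x _; exact: cf.
- apply: (@cvg_comp _ _ _ (fun x => x / d) (@atan R)); last exact: cvgy_atan.
  by apply: gt0_cvgMly; [rewrite invr_gt0|exact: cvg_id].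
- apply: cvg_at_right_filter.
  by apply: differentiable_continuous; apply/derivable1_diffP/ex_derive.
- by move=> x _; rewrite derive1E; exact: derive_val.
Qed.

(** Used to discard the frequency 0, a pole of the resolvent. Only [g] is
assumed measurable: the measurability of [f] away from [a] follows. *)
Lemma eq_integral_off_point (R : realType) (f g : R -> \bar R) (a : R) :
  measurable_fun [set: R] g -> (forall x, x != a -> f x = g x) ->
  (\int[@lebesgue_measure R]_x f x = \int[@lebesgue_measure R]_x g x)%E.
Proof.
move=> mg fg.
have mD : measurable ([set: R] `\ a)%classic by exact: measurableD.
have fgD : {in ([set: R] `\ a)%classic, f =1 g}.
  by move=> x; rewrite inE/= => -[_ /eqP]; exact: fg.
have mgD : measurable_fun ([set: R] `\ a)%classic g by exact: measurable_funTS.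
rewrite -(@integral_setD1 _ f a)//; last first.
  by apply: eq_measurable_fun mgD => x /fgD ->.
by rewrite -[RHS](@integral_setD1 _ g a)//; apply: eq_integral.
Qed.

Lemma measurable_lorentzian (R : realType) (d : R) : 0 <= d ->
  measurable_fun [set: R] (fun w : R => d / (w ^+ 2 + d ^+ 2)).
Proof.
rewrite le_eqVlt => /predU1P[<-|d0].
  by apply: eq_measurable_fun (measurable_cst (0 : R)) => w _; rewrite mul0r.
exact: continuous_measurable_fun (lorentzian_continuous d0).
Qed.

(** * Gram matrices and their diagonalization *)

Local Notation "B ^H" := (hermitian_conj B) (at level 8, format "B ^H").
Local Notation normc := Normc.normc.

Lemma hermitian_conjM (R : realType) (p q s : nat) (B : 'M[R[i]]_(p, q))
    (C : 'M[R[i]]_(q, s)) : (B *m C)^H = C^H *m B^H.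
Proof. by rewrite /hermitian_conj trmx_mul map_mxM. Qed.

Lemma hermitian_conjK (R : realType) (p q : nat) (B : 'M[R[i]]_(p, q)) :
  B^H^H = B.
Proof. by apply/matrixP => i j; rewrite !mxE conjcK. Qed.

Lemma hermitian_conj_complexify (R : realType) (p q : nat) (B : 'M[R]_(p, q)) :
  (complexify B)^H = complexify B^T.
Proof. by apply/matrixP => i j; rewrite !mxE/= oppr0. Qed.

Lemma hermitian_conj_diag (R : realType) (p : nat) (d : 'rV[R[i]]_p) :
  (diag_mx d)^H = diag_mx (map_mx (@conjc R) d).
Proof. by rewrite /hermitian_conj tr_diag_mx map_diag_mx. Qed.

Lemma gram_diagE (R : realType) (p q : nat) (B : 'M[R[i]]_(p, q)) j :
  (B^H *m B) j j = (\sum_i normc (B i j) ^+ 2)%:C%C.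
Proof.
rewrite mxE rmorph_sum; apply: eq_bigr => i _; rewrite !mxE.
case: (B i j) => a b /=; rewrite sqr_sqrtr ?addr_ge0 ?sqr_ge0//.
by apply/eqP; rewrite eq_complex/=; apply/andP; split; apply/eqP; ring.
Qed.

Lemma mxtrace_gramE (R : realType) (p q : nat) (B : 'M[R[i]]_(p, q)) :
  \tr (B^H *m B) = (\sum_j \sum_i normc (B i j) ^+ 2)%:C%C.
Proof. by rewrite rmorph_sum; apply: eq_bigr => j _; exact: gram_diagE. Qed.

Lemma sqr_frobenius_norm (R : realType) (p q : nat) (B : 'M[R[i]]_(p, q)) :
  frobenius_norm B ^+ 2 = complex.Re (\tr (B^H *m B)).
Proof.
rewrite sqr_sqrtr// mxtrace_gramE/=.
by apply: sumr_ge0 => j _; apply: sumr_ge0 => i _; exact: sqr_ge0.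
Qed.

Lemma gram_eq0 (R : realType) (p q : nat) (B : 'M[R[i]]_(p, q)) :
  B^H *m B = 0 -> B = 0.
Proof.
move=> B0; apply/matrixP => i j; rewrite mxE.
have /eqP := gram_diagE B j; rewrite B0 mxE eq_sym -(rmorph0 (real_complex R)).
rewrite (inj_eq (@complexI R)) psumr_eq0; last by move=> *; exact: sqr_ge0.
move=> /allP/(_ i (mem_index_enum i)); rewrite sqrf_eq0 => /eqP.
exact: Normc.eq0_normc.
Qed.

(** The eigenvalues are nonnegative because the j-th one is the squared norm of
the j-th column of Q U^H. *)
Lemma gram_spectral (R : realType) (n k : nat) (Q : 'M[R]_(k, n)) :
  exists U : 'M[R[i]]_n, exists d : 'rV[R]_n,
  [/\ U^H *m U = 1%:M, U *m U^H = 1%:M, forall j, 0 <= d 0 j &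
      complexify (Q^T *m Q) = U^H *m diag_mx (complexify d) *m U].
Proof.
set L := complexify _.
have Lherm : L \is hermsymmx.
  apply: realsym_hermsym; first last.
    by apply/mxOverP => i j; rewrite mxE complex_real.
  apply/is_hermitianmxP; rewrite expr0 scale1r.
  by rewrite map_mx_id// /L /complexify map_trmx trmx_mul trmxK.
have /hermitian_normalmx/orthomx_spectralP := Lherm.
have dreal := hermitian_spectral_diag_real Lherm.
have := spectral_unitarymx L.
move: (spectralmx L) (spectral_diag L) dreal => U dc dreal Uu.
rewrite invmx_unitary// => LE.
have UE : U^t*%sesqui = U^H by [].
rewrite {}UE in LE.
have UU : U *m U^H = 1%:M by move/unitarymxP: Uu; rewrite /hermitian_conj.
have UU' : U^H *m U = 1%:M by exact: mulmx1C.
pose d := map_mx (@complex.Re R) dc.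
have dE : dc = complexify d.
  by apply/matrixP => i j; rewrite !mxE RRe_real//; exact: (mxOverP dreal).
exists U, d; split; [exact: UU'|exact: UU| |by rewrite -dE].
move=> j; rewrite -lecR.
have : diag_mx dc = (complexify Q *m U^H)^H *m (complexify Q *m U^H).
  rewrite hermitian_conjM hermitian_conjK !mulmxA -(mulmxA U).
  rewrite hermitian_conj_complexify -map_mxM -/(complexify _) -/L LE.
  by rewrite !mulmxA UU mul1mx -mulmxA UU mulmx1.
move=> /matrixP/(_ j j); rewrite gram_diagE mxE eqxx mulr1n dE mxE => ->.
by rewrite lecR; apply: sumr_ge0 => i _; exact: sqr_ge0.
Qed.

(** * The H^2 norm of Q (s + Q^T Q)^-1 B *)

(** The left-hand side is the orthogonal projection P onto the kernel of
Q^T Q, which is the line of constant vectors. The columns of P lie in that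
kernel, so P has constant columns, and constant rows since it is Hermitian;
the value of the constant comes from P fixing the constant vectors. This
avoids counting the null eigenvalues. *)
Lemma kernel_projection (R : realType) (n k : nat) (Q : 'M[R]_(k, n))
    (U : 'M[R[i]]_n) (d : 'rV[R]_n) :
  U^H *m U = 1%:M -> U *m U^H = 1%:M ->
  complexify (Q^T *m Q) = U^H *m diag_mx (complexify d) *m U ->
  Q *m (const_mx 1 : 'cV_n) = 0 ->
  (forall x : 'cV[R[i]]_n, complexify Q *m x = 0 ->
     forall i j, x i 0 = x j 0) ->
  U^H *m diag_mx (\row_j (d 0 j == 0)%:R) *m U = const_mx n%:R^-1.
Proof.
move=> UU UU' LE Q1 Qker; set Z := diag_mx _; set P := U^H *m Z *m U.
have PH : P^H = P.
  rewrite /P !hermitian_conjM hermitian_conjK hermitian_conj_diag mulmxA.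
  congr (_ *m diag_mx _ *m _); apply/matrixP => i j; rewrite !mxE.
  exact: conjc_nat.
have LP : complexify (Q^T *m Q) *m P = 0.
  rewrite LE /P !mulmxA -(mulmxA _ U) UU' mulmx1 -(mulmxA U^H).
  suff -> : diag_mx (complexify d) *m Z = 0 by rewrite mulmx0 mul0mx.
  apply/matrixP => i j; rewrite mul_diag_mx !mxE.
  by have [->|] := eqVneq; rewrite ?mul0r// mul0rn mulr0.
have QP : complexify Q *m P = 0.
  apply: gram_eq0; rewrite hermitian_conjM hermitian_conj_complexify.
  by rewrite -mulmxA (mulmxA (complexify Q^T)) -map_mxM LP mulmx0.
have Prow i j l : P i l = P j l.
  have := Qker (col l P); rewrite [X in _ *m X]colE mulmxA QP mul0mx.
  by move=> /(_ erefl i j); rewrite !mxE.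
have Pconst i j i' j' : P i j = P i' j'.
  rewrite (Prow i i'); have PE a b : P a b = conjc (P b a).
    by rewrite -[in LHS]PH !mxE.
  by rewrite (PE i' j) (PE i' j') (Prow j j').
have P1 : P *m (const_mx 1 : 'cV_n) = const_mx 1.
  have L1 : complexify (Q^T *m Q) *m (const_mx 1 : 'cV_n) = 0.
    have -> : (const_mx 1 : 'cV[R[i]]_n) = complexify (const_mx 1).
      by rewrite /complexify map_const_mx.
    by rewrite /complexify -map_mxM -mulmxA Q1 mulmx0 map_mx0.
  set y := U *m (const_mx 1 : 'cV_n).
  have Dy : diag_mx (complexify d) *m y = 0.
    have := congr1 (mulmx U) L1.
    by rewrite LE -mulmxA !mulmxA UU' mul1mx mulmx0 -mulmxA.
  have Zy : Z *m y = y.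
    apply/matrixP => i j; have /matrixP/(_ i j) := Dy.
    rewrite !mul_diag_mx !mxE; case: eqVneq => [_ _|d0]; first by rewrite mul1r.
    move=> /eqP; rewrite mulf_eq0 => /orP[/eqP/complexI/eqP|/eqP->].
      by rewrite (negbTE d0).
    by rewrite mulr0.
  by rewrite /P -!mulmxA -/y Zy /y mulmxA UU mul1mx.
apply/matrixP => i j; rewrite [RHS]mxE.
have /matrixP/(_ i 0) := P1; rewrite mxE [RHS]mxE.
under eq_bigr do rewrite (Pconst i _ i j) [X in _ * X]mxE mulr1.
rewrite sumr_const card_ord => Pn; rewrite -mulr_natr in Pn.
have n0 : (n%:R : R[i]) != 0.
  by apply/eqP => n0; move/eqP: Pn; rewrite n0 mulr0 eq_sym oner_eq0.
by apply: (mulIf n0); rewrite Pn mulVf.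
Qed.

Lemma invmx_uniq (F : comUnitRingType) (n : nat) (A B : 'M[F]_n) :
  A *m B = 1%:M -> invmx A = B.
Proof.
move=> AB; have [Au _] := mulmx1_unit AB.
by rewrite -[LHS]mulmx1 -AB mulmxA mulVmx// mul1mx.
Qed.

(** In the eigenbasis the resolvent is the diagonal matrix of the
1 / (i w + d_j) and Q^T Q that of the d_j, so the Gram matrix of the transfer
function is X^H D X with D diagonal of entries d_j / |i w + d_j|^2. *)
Lemma sqr_frobenius_norm_resolvent (R : realType) (n m k : nat)
    (Q : 'M[R]_(k, n)) (B : 'M[R]_(n, m)) (U : 'M[R[i]]_n) (d : 'rV[R]_n)
    (X := U *m complexify B) (w : R) :
  U^H *m U = 1%:M -> U *m U^H = 1%:M ->
  complexify (Q^T *m Q) = U^H *m diag_mx (complexify d) *m U ->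
  w != 0 ->
  frobenius_norm (complexify Q *m
      invmx ((Complex 0 w)%:M + complexify (Q^T *m Q)) *m complexify B) ^+ 2 =
  \sum_j complex.Re ((X *m X^H) j j) * (d 0 j / (w ^+ 2 + d 0 j ^+ 2)).
Proof.
move=> UU UU' LE w0.
pose z j : R[i] := Complex (d 0 j) w.
have z0 j : z j != 0 by rewrite eq_complex/= negb_and w0 orbT.
have -> : invmx ((Complex 0 w)%:M + complexify (Q^T *m Q)) =
    U^H *m diag_mx (\row_j (z j)^-1) *m U.
  apply: invmx_uniq.
  have -> : (Complex 0 w)%:M + complexify (Q^T *m Q) =
      U^H *m diag_mx (\row_j z j) *m U.
    have -> : diag_mx (\row_j z j) =
        (Complex 0 w)%:M + diag_mx (complexify d).
      apply/matrixP => i j; rewrite !mxE; case: eqP => _; last first.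
        by rewrite !mulr0n addr0.
      by apply/eqP; rewrite !mulr1n eq_complex/= add0r addr0 !eqxx.
    rewrite mulmxDr mulmxDl -LE; congr (_ + _).
    by rewrite mul_mx_scalar -scalemxAl UU scalemx1.
  rewrite !mulmxA -(mulmxA _ U) UU' mulmx1 -(mulmxA U^H).
  suff -> : diag_mx (\row_j z j) *m diag_mx (\row_j (z j)^-1) = 1%:M.
    by rewrite mulmx1.
  apply/matrixP => i j; rewrite mul_diag_mx !mxE.
  by case: eqP => _; rewrite ?mulr1n ?mulfV// !mulr0n mulr0.
rewrite !mulmxA -mulmxA -/X sqr_frobenius_norm; clearbody X.
set E := diag_mx _.
have -> : (complexify Q *m U^H *m E *m X)^H *m (complexify Q *m U^H *m E *m X) =
    X^H *m (E^H *m diag_mx (complexify d) *m E *m X).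
  have <- : U *m complexify Q^T *m (complexify Q *m U^H) =
      diag_mx (complexify d).
    rewrite mulmxA -(mulmxA U) -map_mxM -/(complexify _) LE !mulmxA UU' mul1mx.
    by rewrite -mulmxA UU' mulmx1.
  rewrite (hermitian_conjM _ X) (hermitian_conjM _ E) (hermitian_conjM _ U^H).
  by rewrite hermitian_conjK hermitian_conj_complexify !mulmxA.
rewrite mxtrace_mulC -(mulmxA _ X).
have -> : E^H *m diag_mx (complexify d) *m E =
    diag_mx (complexify (\row_j (d 0 j / (w ^+ 2 + d 0 j ^+ 2)))).
  rewrite hermitian_conj_diag !mulmx_diag; congr diag_mx.
  apply/matrixP => i j; rewrite !mxE conjc_inv.
  rewrite mulrAC mulrC -invfM mulrC.
  have -> : conjc (z j) * z j = (w ^+ 2 + d 0 j ^+ 2)%:C%C.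
    by apply/eqP; rewrite eq_complex/=; apply/andP; split; apply/eqP; ring.
  by rewrite mulrC rmorphM fmorphV.
rewrite /mxtrace raddf_sum/=; apply: eq_bigr => j _.
rewrite mul_diag_mx !mxE.
by case: (\sum_(_ < _) _) => a b /=; rewrite mul0r subr0 mulrC.
Qed.

(** A mode with d_j = 0 is unobservable and contributes nothing; each of the
others contributes its weight times the same constant pi. *)
Lemma integral_modes (R : realType) (n : nat) (c d : 'I_n -> R) :
  (forall j, 0 <= c j) -> (forall j, 0 <= d j) ->
  (\int[@lebesgue_measure R]_w
     (\sum_j c j * (d j / (w ^+ 2 + d j ^+ 2)))%:E =
   (pi * \sum_j c j * (d j != 0)%:R)%:E)%E.
Proof.
move=> c_ge0 d_ge0.
pose f j (w : R) := (d j / (w ^+ 2 + d j ^+ 2)).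
have f_ge0 j (w : R) : 0 <= f j w by rewrite divr_ge0// addr_ge0 ?sqr_ge0.
have mf j : measurable_fun [set: R] (f j) by exact: measurable_lorentzian.
have mcf j : measurable_fun [set: R] (fun w => (c j * f j w)%:E).
  by apply: measurableT_comp => //; exact: measurable_funM.
under eq_integral do rewrite -sumEFin.
rewrite ge0_integral_sum//; last first.
  by move=> j w _; rewrite lee_fin; exact: mulr_ge0 (c_ge0 j) (f_ge0 j w).
rewrite mulr_sumr -sumEFin; apply: eq_bigr => j _.
under eq_integral do rewrite EFinM.
rewrite ge0_integralZl_EFin//; last 2 first.
- by move=> w _; rewrite lee_fin f_ge0.
- by apply: measurableT_comp => //; exact: mf.
have [dj|dj] := eqVneq (d j) 0.
  by under eq_integral do rewrite dj mul0r; rewrite integral0 mule0 !mulr0.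
by rewrite integral_lorentzian ?lt_def ?dj//= -EFinM mulr1 mulrC.
Qed.

(** Integrating the modes leaves half the squared norm of the components of B
along the nonzero eigenvalues, that is, of B minus its projection on the
constant vectors. *)
Lemma sqr_H2_norm_resolvent (R : realType) (n m k : nat)
    (Q : 'M[R]_(k, n)) (B : 'M[R]_(n, m)) :
  Q *m (const_mx 1 : 'cV_n) = 0 ->
  (forall x : 'cV[R[i]]_n, complexify Q *m x = 0 ->
     forall i j, x i 0 = x j 0) ->
  (H2_norm (fun s : R[i] => complexify Q *m
      invmx (s%:M + complexify (Q^T *m Q)) *m complexify B) ^+ 2 =
   (\tr (B^T *m (1%:M - const_mx n%:R^-1) *m B) / 2)%:E)%E.
Proof.
move=> Q1 Qker; have [U [d [UU UU' d_ge0 LE]]] := gram_spectral Q.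
have PE := kernel_projection UU UU' LE Q1 Qker.
set X := U *m complexify B.
pose c j := complex.Re ((X *m X^H) j j).
have c_ge0 j : 0 <= c j.
  rewrite /c -{1}(hermitian_conjK X) gram_diagE/=.
  by apply: sumr_ge0 => l _; exact: sqr_ge0.
pose g (w : R) := (\sum_j c j * (d 0 j / (w ^+ 2 + d 0 j ^+ 2)))%:E.
rewrite sqr_sqrte; last first.
  rewrite mule_ge0 ?lee_fin ?invr_ge0 ?mulr_ge0 ?pi_ge0//.
  by apply: integral_ge0 => w _; rewrite lee_fin sqr_ge0.
rewrite (@eq_integral_off_point _ _ g 0); first last.
- by move=> w w0; rewrite (sqr_frobenius_norm_resolvent B UU UU' LE w0).
- apply: measurableT_comp => //; apply: measurable_sum => j.
  by apply: measurable_funM => //; exact: measurable_lorentzian.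
rewrite integral_modes// -EFinM; congr EFin.
have -> : \sum_j c j * (d 0 j != 0)%:R =
    complex.Re (\tr (X^H *m (1%:M - diag_mx (\row_j (d 0 j == 0)%:R)) *m X)).
  rewrite -mulmxA mxtrace_mulC -mulmxA /mxtrace raddf_sum/=.
  apply: eq_bigr => j _; rewrite /c.
  rewrite mulmxBl mul1mx mul_diag_mx !mxE.
  by case: eqP => _; rewrite ?mul1r ?subrr ?mulr0// mul0r subr0 mulr1.
have -> : X^H *m (1%:M - diag_mx (\row_j (d 0 j == 0)%:R)) *m X =
    complexify (B^T *m (1%:M - const_mx n%:R^-1) *m B).
  rewrite /X hermitian_conjM hermitian_conj_complexify.
  transitivity (complexify B^T *m (U^H *m U -
      U^H *m diag_mx (\row_j (d 0 j == 0)%:R) *m U) *m complexify B).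
    by rewrite !(mulmxBr, mulmxBl) mulmx1 !mulmxA.
  rewrite UU PE /complexify !map_mxM map_mxB map_mx1 map_const_mx.
  suff <- : (n%:R^-1 : R)%:C%C = n%:R^-1 by [].
  by rewrite fmorphV rmorph_nat.
rewrite /complexify trace_map_mx/=.
have pi0 : (pi : R) != 0 by rewrite gt_eqF// pi_gt0.
by move: (\tr _) (pi : R) pi0 => t p p0; field.
Qed.

(** * The incidence factorization of the Laplacian *)

Lemma output_matrixE (R : realType) (n k : nat) (A : 'M[R]_n)
    (src snk : 'I_k -> 'I_n) e i : src e != snk e ->
  output_matrix A src snk e i =
  Num.sqrt (A (src e) (snk e)) * ((i == src e)%:R - (i == snk e)%:R).
Proof.
move=> esrc; rewrite /output_matrix /sqrt_weights mul_diag_mx !mxE.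
congr (_ * _); case: eqVneq => [->|_]; first by rewrite (negbTE esrc) subr0.
by case: eqP => _; rewrite ?mulr1n ?mulr0n ?sub0r ?oppr0.
Qed.

Lemma sum_indicator (R : pzSemiRingType) (I : finType) (a : I) (F : I -> R) :
  \sum_i (i == a)%:R * F i = F a.
Proof.
rewrite (bigD1 a)//= eqxx mul1r big1 ?addr0// => i /negbTE ->.
by rewrite mul0r.
Qed.

Lemma edge_ends_neq (R : realType) (n k : nat) (A : 'M[R]_n)
    (src snk : 'I_k -> 'I_n) e :
  connected_weighted_graph A -> oriented_edge_numbering A src snk ->
  src e != snk e.
Proof.
move=> [_ _ A0 _] [adj _]; have := adj e; rewrite /Defs.adjacent.
by apply: contraTneq => ->; rewrite A0 ltxx.
Qed.

Lemma output_matrix_ones (R : realType) (n k : nat) (A : 'M[R]_n)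
    (src snk : 'I_k -> 'I_n) :
  connected_weighted_graph A -> oriented_edge_numbering A src snk ->
  output_matrix A src snk *m (const_mx 1 : 'cV_n) = 0.
Proof.
move=> GA EA; apply/matrixP => e j; rewrite mxE [RHS]mxE.
under eq_bigr do rewrite (output_matrixE _ _ (edge_ends_neq e GA EA)) mxE mulr1.
rewrite -mulr_sumr sumrB.
under eq_bigr do rewrite -[_%:R]mulr1.
under [X in _ - X]eq_bigr do rewrite -[_%:R]mulr1.
by rewrite !(sum_indicator _ (fun=> 1)) subrr mulr0.
Qed.

(** A vector killed by Q takes equal values at the two ends of each edge, and
then along each path. *)
Lemma output_matrix_kernel (R : realType) (n k : nat) (A : 'M[R]_n)
    (src snk : 'I_k -> 'I_n) (x : 'cV[R[i]]_n) :
  connected_weighted_graph A -> oriented_edge_numbering A src snk ->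
  complexify (output_matrix A src snk) *m x = 0 -> forall i j, x i 0 = x j 0.
Proof.
move=> GA EA Qx i j.
have xe e : x (src e) 0 = x (snk e) 0.
  have /matrixP/(_ e 0) := Qx; rewrite mxE [RHS]mxE.
  under eq_bigr do rewrite mxE (output_matrixE _ _ (edge_ends_neq e GA EA))
    rmorphM rmorphB/= !rmorph_nat -mulrA mulrBl.
  rewrite -mulr_sumr sumrB !sum_indicator => /eqP; rewrite mulf_eq0.
  move=> /orP[/eqP/complexI/eqP|]; last by rewrite subr_eq0 => /eqP.
  by rewrite sqrtr_eq0 leNgt; move: (proj1 EA e); rewrite /Defs.adjacent => ->.
have [_ _ _ /(_ i j)/connectP[p]] := GA.
elim: p i => [|i' p IHp] i /=; first by move=> _ ->.
move=> /andP[ii' pp] jE; rewrite -(IHp i')//.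
have [e [[[<- <-]|[<- <-]] _]] := proj2 EA _ _ ii'; by rewrite xe.
Qed.

(** Off the diagonal, an entry of Q^T Q collects minus the weight of the unique
edge joining two vertices, if any. The diagonal is then forced, as the rows of
both matrices sum to zero. *)
Lemma laplacian_gram (R : realType) (n k : nat) (A : 'M[R]_n)
    (src snk : 'I_k -> 'I_n) :
  connected_weighted_graph A -> oriented_edge_numbering A src snk ->
  laplacian A = (output_matrix A src snk)^T *m output_matrix A src snk.
Proof.
move=> GA EA; set Q := output_matrix A src snk.
have [Asym A_ge0 A0 _] := GA.
have off i j : i != j -> laplacian A i j = (Q^T *m Q) i j.
  move=> ij; rewrite !mxE (negbTE ij) mulr0n sub0r.
  have QQ e : Q^T i e * Q e j = - (A i j *
      ((i == src e) && (j == snk e) || (i == snk e) && (j == src e))%:R).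
    have sn := edge_ends_neq e GA EA.
    rewrite mxE /Q !output_matrixE// mulrACA -expr2 sqr_sqrtr//.
    have [iE|si] := eqVneq i (src e).
      have ti : (i == snk e) = false by rewrite iE (negbTE sn).
      have sj : (j == src e) = false by rewrite -iE eq_sym (negbTE ij).
      rewrite ti sj andbF orbF; case: eqP => [->|_] /=; rewrite ?iE; ring.
    have [iE|ti] := eqVneq i (snk e); last by rewrite /=; ring.
    have tj : (j == snk e) = false by rewrite -iE eq_sym (negbTE ij).
    rewrite tj; case: eqP => [->|_] /=; last by ring.
    by rewrite iE -[in RHS]Asym mxE; ring.
  under eq_bigr do rewrite QQ.
  rewrite sumrN -mulr_sumr; congr (- _).
  have [Aij|] := boolP (Defs.adjacent A i j); last first.
    rewrite /Defs.adjacent -leNgt => Aij.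
    by rewrite (@le_anti _ _ (A i j) 0) ?mul0r// Aij A_ge0.
  have [e [eij e_uniq]] := proj2 EA _ _ Aij.
  rewrite (bigD1 e)//= big1 => [|e' e'e].
    rewrite addr0 [X in nat_of_bool X](_ : _ = true) ?mulr1//.
    by case: eij => -[-> ->]; rewrite !eqxx ?orbT.
  rewrite [X in nat_of_bool X](_ : _ = false)//; apply: contraNF e'e => ee.
  apply/eqP/esym/e_uniq.
  by case/orP: ee => /andP[/eqP-> /eqP->]; [left|right].
have ones (M : 'M[R]_n) i : M *m (const_mx 1 : 'cV_n) = 0 ->
    M i i = - \sum_(j | j != i) M i j.
  move=> /matrixP/(_ i 0); rewrite mxE [RHS]mxE.
  under eq_bigr do rewrite [X in _ * X]mxE mulr1.
  by rewrite (bigD1 i)//= => /eqP; rewrite addr_eq0 => /eqP.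
apply/matrixP => i j; have [<-|ij] := eqVneq i j; last exact: off.
rewrite !ones; first last.
- apply/matrixP => a b; rewrite mxE [RHS]mxE.
  under eq_bigr do rewrite [X in _ * X]mxE mulr1.
  have lapE c : laplacian A a c = (\sum_l A a l) *+ (a == c) - A a c.
    by rewrite !mxE.
  under eq_bigr do rewrite lapE.
  rewrite sumrB [X in X - _](bigD1 a)//= eqxx mulr1n.
  rewrite [X in _ + X - _]big1 ?addr0 ?subrr//.
  by move=> c ca; rewrite eq_sym (negbTE ca).
- by rewrite -mulmxA output_matrix_ones// mulmx0.
by congr (- _); apply: eq_bigr => c ca; rewrite off// eq_sym.
Qed.

(** * Leader selection and demotion *)

(** The two transfer functions share the factor Q (s + L)^-1, so that their
difference is the transfer function of the difference of the input
matrices. *)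
Lemma selection_cost_trace (R : realType) (n m k : nat) (A : 'M[R]_n)
    (src snk : 'I_k -> 'I_n) (v : 'I_m -> 'I_n) (Vd : {set 'I_n})
    (vt : {ffun kept v Vd -> 'I_n})
    (B := leader_matrix R v - new_leader_matrix R vt) :
  connected_weighted_graph A -> oriented_edge_numbering A src snk ->
  selection_cost A src snk vt =
  (\tr (B^T *m (1%:M - const_mx n%:R^-1) *m B) / 2)%:E.
Proof.
move=> GA EA.
rewrite -(@sqr_H2_norm_resolvent _ _ _ _ (output_matrix A src snk)).
- rewrite /selection_cost; congr (H2_norm _ ^+ 2)%E; apply: funext => s.
  rewrite /leader_transfer -mulmxBr (laplacian_gram GA EA).
  by rewrite /B /complexify map_mxB.
- exact: output_matrix_ones.
- by move=> x; exact: output_matrix_kernel.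
Qed.

(** I - J / n subtracts its mean from a column, so the trace adds up the
squared deviations from the mean, as in the usual formula for a variance. *)
Lemma mxtrace_centered_gram (R : realType) (n m : nat) (B : 'M[R]_(n, m)) :
  \tr (B^T *m (1%:M - const_mx n%:R^-1) *m B) =
  \sum_l (\sum_i B i l ^+ 2 - (\sum_i B i l) ^+ 2 / n%:R).
Proof.
apply: eq_bigr => l _; rewrite mulmxBr mulmx1 mulmxBl !mxE; congr (_ - _).
  by apply: eq_bigr => i _; rewrite mxE expr2.
rewrite expr2 mulrAC mulr_sumr; apply: eq_bigr => i _; congr (_ * _).
by rewrite mxE mulr_suml; apply: eq_bigr => j _; rewrite !mxE.
Qed.

Lemma new_leader_matrix_demoted (R : realType) (n m : nat) (v : 'I_m -> 'I_n)
    (Vd : {set 'I_n}) (vt : {ffun kept v Vd -> 'I_n}) i l :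
  v l \in Vd -> new_leader_matrix R vt i l = 0.
Proof.
move=> vl; rewrite mxE; case: existsP => // -[l' /andP[/eqP l'l _]].
by have := valP l'; rewrite l'l vl.
Qed.

Lemma new_leader_matrix_kept (R : realType) (n m : nat) (v : 'I_m -> 'I_n)
    (Vd : {set 'I_n}) (vt : {ffun kept v Vd -> 'I_n}) i (l : kept v Vd) :
  new_leader_matrix R vt i (val l) = (i == vt l)%:R.
Proof.
rewrite mxE; congr (nat_of_bool _)%:R; apply/existsP/idP => [[l']|il].
  by case/andP => /eqP/val_inj ->.
by exists l; rewrite eqxx.
Qed.

Lemma sum_eq_op (R : pzSemiRingType) (I : finType) (a : I) :
  \sum_i (i == a)%:R = 1 :> R.
Proof.
by have := sum_indicator a (fun=> 1 : R); under eq_bigr do rewrite mulr1.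
Qed.

Lemma sum_sqr_indicatorB (R : comPzRingType) (I : finType) (a b : I) :
  \sum_i ((i == a)%:R - (i == b)%:R) ^+ 2 = (2 * (a != b))%:R :> R.
Proof.
have [->|ab] := eqVneq a b.
  by rewrite big1 ?muln0// => i _; rewrite subrr expr0n.
have E i : ((i == a)%:R - (i == b)%:R) ^+ 2 = (i == a)%:R + (i == b)%:R :> R.
  have [->|_] := eqVneq i a; first by rewrite (negbTE ab) /=; ring.
  by case: (i == b) => /=; ring.
by under eq_bigr do rewrite E; rewrite big_split/= !sum_eq_op.
Qed.

(** The column of the input difference at a demoted leader is a basis vector,
of centered squared norm 1 - 1/n. At a kept leader it is a difference of two
basis vectors, whose entries have mean 0 and whose squared norm is 0 or 2. *)
Lemma selection_costE (R : realType) (n m k : nat) (A : 'M[R]_n)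
    (src snk : 'I_k -> 'I_n) (v : 'I_m -> 'I_n) (Vd : {set 'I_n})
    (vt : {ffun kept v Vd -> 'I_n}) :
  connected_weighted_graph A -> oriented_edge_numbering A src snk ->
  injective v -> Vd \subset leader_set v ->
  selection_cost A src snk vt =
  (#|Vd|%:R / 2 * (1 - n%:R^-1) + #|[set l | vt l != v (val l)]|%:R)%:E.
Proof.
move=> GA EA v_inj VdS.
rewrite selection_cost_trace// mxtrace_centered_gram; congr EFin.
rewrite (bigID (fun l => v l \in Vd))/=.
rewrite (eq_bigr (fun=> 1 - n%:R^-1)); last first.
  move=> l vl.
  have Bl i : (leader_matrix R v - new_leader_matrix R vt) i l =
      (i == v l)%:R.
    by rewrite mxE [X in _ + X]mxE new_leader_matrix_demoted// subr0 mxE.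
  under eq_bigr do rewrite Bl.
  under [X in _ - X ^+ 2 / _]eq_bigr do rewrite Bl.
  rewrite sum_eq_op expr1n mul1r; congr (_ - _).
  rewrite -[RHS](sum_eq_op _ (v l)); apply: eq_bigr => i _.
  by case: eqP => _ /=; ring.
rewrite [X in _ + X](_ : _ = 2 * #|[set l | vt l != v (val l)]|%:R); last first.
  rewrite (big_sub (fun l => v l \notin Vd))/= -sum1_card natr_sum mulr_sumr.
  rewrite big_mkcond [RHS]big_mkcond/=; apply: eq_bigr => l _.
  have Bl i : (leader_matrix R v - new_leader_matrix R vt) i (val l) =
      (i == v (val l))%:R - (i == vt l)%:R.
    by rewrite mxE [X in _ + X]mxE new_leader_matrix_kept mxE.
  under eq_bigr do rewrite Bl.
  under [X in _ - X ^+ 2 / _]eq_bigr do rewrite Bl.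
  rewrite sum_sqr_indicatorB sumrB !sum_eq_op subrr expr0n mul0r subr0 inE.
  by rewrite eq_sym; case: eqP => _ /=; ring.
rewrite sumr_const.
have -> : #|[pred l | v l \in Vd]| = #|Vd|.
  rewrite -(card_imset _ v_inj); apply: eq_card => i.
  apply/imsetP/idP => [[l vl ->//]|iV].
  have /imsetP[l _ il] := fintype.subsetP VdS _ iV.
  by exists l; rewrite // inE -il.
rewrite -[X in X + _]mulr_natr; set N := #|[set l | _]|; rewrite -/N.
by move: (n%:R^-1) => t; field.
Qed.

(** The number of moved leaders is the only part of the cost that depends on the
choice of the new leaders, and it vanishes if the remaining leaders stay. *)
Lemma demotion_cost_feasible (R : realType) (n m k : nat) (A : 'M[R]_n)
    (src snk : 'I_k -> 'I_n) (v : 'I_m -> 'I_n) (Vd : {set 'I_n}) :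
  connected_weighted_graph A -> oriented_edge_numbering A src snk ->
  injective v -> Vd \subset leader_set v ->
  demotion_cost A src snk v Vd = (#|Vd|%:R / 2 * (1 - n%:R^-1))%:E.
Proof.
move=> GA EA v_inj VdS.
have remE : selection_cost A src snk (remaining_leaders v Vd) =
    (#|Vd|%:R / 2 * (1 - n%:R^-1))%:E.
  rewrite selection_costE// [X in (_ + X%:R)%:E]eq_card0 ?addr0// => l.
  by rewrite !inE ffunE eqxx.
apply: (etrans _ remE); apply: (demotion_costE v_inj); split.
  exact: remaining_leadersP.
by move=> vt _; rewrite remE selection_costE// lee_fin lerDl.
Qed.

Theorem theorem2 (R : realType) (n k m r : nat) (A : 'M[R]_n)
    (src snk : 'I_k -> 'I_n) (v : 'I_m -> 'I_n)
    (A_graph : connected_weighted_graph A)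
    (edgesP : oriented_edge_numbering A src snk)
    (v_inj : injective v)
    (r_range : (1 <= r <= m)%N)
    (Vd : {set 'I_n}) (VdP : Vd \subset leader_set v) (card_Vd : #|Vd| = r) :
  demotion_solution A src snk v r Vd /\
  demotion_cost A src snk v Vd = (r%:R / 2 * (1 - n%:R^-1))%:E.
Proof.
split; last by rewrite demotion_cost_feasible// card_Vd.
split=> [//|Vd' [Vd'P card_Vd']].
by rewrite !demotion_cost_feasible// card_Vd card_Vd'.
Qed.
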